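(* Let $Y$ be a topological vector space, $C\subset Y$ a non-trivial closed convex cone and $k\in-\operatorname{core}C$. For the Minkowski functional $p_{C+k}$ we have $$p_{C+k}(y)=\begin{cases}\varphi_{C,k}(y)&\text{if }y\in Y\setminus C,\\0&\text{if }y\in C,\end{cases}$$ i.e. $p_{C+k}(y)=\max\{\varphi_{C,k}(y),0\}$ for all $y\in Y$. Moreover, $p_{C+k}$ is sublinear and lower semicontinuous.
   Context: Vector spaces are real. A set $C$ is a cone if $\lambda c\in C$ for all $\lambda\ge0$, $c\in C$; it is non-trivial if $C\neq\{0\}$ and $C\neq Y$ (and nonempty). $\operatorname{core}C$ is the algebraic interior of $C$. The Minkowski functional of a set $M\subseteq Y$ is $p_M(y)=\inf\{\lambda>0\mid y\in\lambda M\}$. For $k\neq0$, $\varphi_{C,k}(y)=\inf\{t\in\mathbb{R}\mid y\in tk+C\}$. *)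

(* Defs.v *)
From HB Require Import structures.
From mathcomp Require Import all_boot all_order all_algebra.
From mathcomp Require Import all_classical all_reals all_analysis.

Set Implicit Arguments.
Unset Strict Implicit.
Unset Printing Implicit Defensive.

Import Order.TTheory GRing.Theory Num.Theory.
Import numFieldNormedType.Exports.

Local Open Scope classical_set_scope.
Local Open Scope ring_scope.

Section defs.
Context {R : realType} {Y : lmodType R}.
Implicit Types (A C M : set Y) (k y : Y) (f : Y -> \bar R).

Definition cone C : Prop :=
  forall (l : R) c, 0 <= l -> C c -> C (l *: c).

Definition nontrivial_cone C : Prop :=
  [/\ cone C, C !=set0, C <> [set 0] & C <> setT].

(* The case t = 0 makes the core of A a subset of A. *)
Definition core A : set Y :=
  [set a | forall y, exists2 d : R, 0 < d &
     forall t : R, 0 <= t <= d -> A (a + t *: y)].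

(* Infima are taken in the extended reals, so that inf of the empty set is
   +oo and inf of a set of reals that is unbounded below is -oo. *)
Definition minkowski_functional M : Y -> \bar R := fun y =>
  ereal_inf [set l%:E | l in [set l : R | 0 < l /\ [set l *: m | m in M] y]].

Definition phi C k : Y -> \bar R := fun y =>
  ereal_inf [set t%:E | t in [set t : R | [set t *: k + c | c in C] y]].

(* As usual for sublinear functionals, real-valuedness is part of the notion. *)
Definition sublinear f : Prop :=
  [/\ forall y, f y \is a fin_num,
      forall (l : R) y, 0 <= l -> f (l *: y) = (l%:E * f y)%E
    & forall x y, (f (x + y)%R <= f x + f y)%E].

End defs.

(* Main.v *)
Require Import Defs.
From HB Require Import structures.
From mathcomp Require Import all_boot all_order all_algebra.
From mathcomp Require Import all_classical all_reals all_analysis.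
From mathcomp Require Import ring.

Set Implicit Arguments.
Unset Strict Implicit.
Unset Printing Implicit Defensive.

Import Order.TTheory GRing.Theory Num.Theory.
Import numFieldNormedType.Exports.

Local Open Scope classical_set_scope.
Local Open Scope ring_scope.

(** Both functionals are infima over the line through y in direction k.
    Because C is a cone, y lies in l (C + k) for l > 0 exactly when y - l k
    lies in C ([minkowski_translateE]), so p is the infimum of the positive
    part of the set A(y) = [ray] C k y of all reals t with y - t k in C, and
    phi is the infimum of A(y) itself ([phiE]).  Since -k belongs to the
    convex cone C, the set A(y) is upward closed ([ray_upward]), and 0 belongs
    to A(y) exactly when y is in C.

    If y is in C, every positive real belongs to A(y), hence p(y) = 0, while
    phi(y) <= 0.  If y is not in C, upward closedness leaves only positive
    reals in A(y), hence p(y) = phi(y) >= 0.  This gives the two formulas.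

    For l > 0 one has A(l y) = l A(y) ([ray_scale]), which gives positive
    homogeneity; A(x) + A(y) is contained in A(x + y) ([ray_add]), which gives
    subadditivity; and A(y) contains a positive real because -k is in the core
    of C ([core_absorbing]), so that p is finite.  For lower semicontinuity, a
    bound p(y) > a >= 0 is witnessed by some b > a outside A(y); as C is
    closed, b stays outside A(z) for z near y, and then p(z) >= b by upward
    closedness. *)

Lemma convex_cone_add (R : realType) (Y : lmodType R) (C : set Y) (x y : Y) :
  cone C -> convex_set C -> C x -> C y -> C (x + y).
Proof.
move=> cC vC Cx Cy.
have h0 : (0 : R) <= 2^-1 by rewrite invr_ge0 ler0n.
have h1 : (2^-1 : R) <= 1 by rewrite invf_le1 ?ler1n ?ltr0n.
(* The sum is twice the midpoint. *)
have := vC x y (Itv01 h0 h1) (mem_set Cx) (mem_set Cy).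
rewrite inE => /(cC 2 _ (ler0n _ _)).
have -> : conv (Itv01 h0 h1) (x : convex_lmodType Y) y
          = 2^-1 *: x + (1 - 2^-1) *: y :> Y by [].
have -> : 1 - 2^-1 = 2^-1 :> R by field.
by rewrite -scalerDr scalerA mulfV ?scale1r ?pnatr_eq0.
Qed.

Lemma core_subset (R : realType) (Y : lmodType R) (A : set Y) :
  core A `<=` A.
Proof.
move=> a /(_ 0)[d d0 /(_ 0)].
by rewrite scaler0 addr0 lexx ltW//; apply.
Qed.

(** An element of the core absorbs every direction after a step d; dividing by
    d, the cone absorbs every vector after a multiple d^-1 of that element. *)
Lemma core_absorbing (R : realType) (Y : lmodType R) (C : set Y) (c y : Y) :
  cone C -> core C c -> exists2 l : R, 0 < l & C (y + l *: c).
Proof.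
move=> cC /(_ y)[d d0 Cd]; exists d^-1; first by rewrite invr_gt0.
have /Cd/(cC d^-1) : 0 <= d <= d by rewrite ltW /=.
rewrite invr_ge0 scalerDr scalerA mulVf ?gt_eqF// scale1r addrC.
by apply; exact: ltW.
Qed.

Definition ray (R : realType) (Y : lmodType R) (C : set Y) (k y : Y) : set R :=
  [set t : R | C (y - t *: k)].

Lemma phiE (R : realType) (Y : lmodType R) (C : set Y) (k y : Y) :
  phi C k y = ereal_inf [set t%:E | t in ray C k y].
Proof.
congr (ereal_inf (image _ _)); apply/seteqP; split=> t /=.
  by move=> [c Cc <-]; rewrite /ray/= addrAC subrr add0r.
by move=> Ct; exists (y - t *: k) => //; rewrite addrC subrK.
Qed.

(** For l > 0 the cone satisfies l C = C, so l (C + k) = C + l k. *)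
Lemma minkowski_translateE (R : realType) (Y : lmodType R) (C : set Y)
    (k y : Y) : cone C ->
  minkowski_functional [set c + k | c in C] y =
  ereal_inf [set l%:E | l in [set l | 0 < l /\ ray C k y l]].
Proof.
move=> cC; congr (ereal_inf (image _ _)); apply/seteqP; split=> l /=.
  move=> [l0 [_ [c Cc <-] <-]]; split=> //.
  by rewrite /ray/= scalerDr addrK; apply: cC => //; exact: ltW.
move=> [l0 Cl]; split=> //.
exists (l^-1 *: (y - l *: k) + k).
  by exists (l^-1 *: (y - l *: k)) => //; apply: cC => //; rewrite invr_ge0 ltW.
by rewrite scalerDr scalerA mulfV ?gt_eqF// scale1r subrK.
Qed.

Lemma ray_upward (R : realType) (Y : lmodType R) (C : set Y) (k y : Y)
    (s t : R) :
  cone C -> convex_set C -> C (- k) -> s <= t -> ray C k y s -> ray C k y t.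
Proof.
move=> cC vC Ck st Cs; rewrite /ray/=.
have -> : y - t *: k = (y - s *: k) + (t - s) *: (- k).
  by rewrite scalerN scalerBl opprB addrA subrK.
by apply: convex_cone_add => //; apply: cC => //; rewrite subr_ge0.
Qed.

Lemma ray_add (R : realType) (Y : lmodType R) (C : set Y) (k x y : Y)
    (s t : R) :
  cone C -> convex_set C ->
  ray C k x s -> ray C k y t -> ray C k (x + y) (s + t).
Proof.
move=> cC vC Cs Ct; rewrite /ray/= scalerDl opprD addrACA.
exact: convex_cone_add.
Qed.

Lemma ray_scale (R : realType) (Y : lmodType R) (C : set Y) (k y : Y)
    (l t : R) : cone C -> 0 < l ->
  ray C k (l *: y) (l * t) <-> ray C k y t.
Proof.
move=> cC l0; rewrite /ray/= -scalerA -scalerBr; split=> [|Ct]; last first.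
  by apply: cC => //; exact: ltW.
move/(cC l^-1); rewrite invr_ge0 scalerA mulVf ?gt_eqF// scale1r.
by apply; exact: ltW.
Qed.

Lemma minkowski_translate_ge0 (R : realType) (Y : lmodType R) (C : set Y)
    (k y : Y) : cone C ->
  (0 <= minkowski_functional [set (c + k)%R | c in C] y)%E.
Proof.
move=> cC; rewrite minkowski_translateE//; apply: le_ereal_inf_tmp.
by move=> _ [l [l0 _] <-]; rewrite lee_fin ltW.
Qed.

Lemma minkowski_translate_in (R : realType) (Y : lmodType R) (C : set Y)
    (k y : Y) : cone C -> convex_set C -> C (- k) -> C y ->
  minkowski_functional [set c + k | c in C] y = 0%E.
Proof.
move=> cC vC Ck Cy; apply/eqP; rewrite eq_le minkowski_translate_ge0// andbT.
rewrite minkowski_translateE//; apply/lee_addgt0Pr => e e0; rewrite add0e.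
apply: ge_ereal_inf; exists e%:E => //; exists e => //; split=> //.
apply: (@ray_upward _ _ _ _ _ 0) => //; first exact: ltW.
by rewrite /ray/= scale0r subr0.
Qed.

Lemma ray_notin_gt0 (R : realType) (Y : lmodType R) (C : set Y) (k y : Y)
    (t : R) : cone C -> convex_set C -> C (- k) -> ~ C y ->
  ray C k y t -> 0 < t.
Proof.
move=> cC vC Ck nCy Ct; rewrite ltNge; apply/negP => t0; apply: nCy.
by have := ray_upward cC vC Ck t0 Ct; rewrite /ray/= scale0r subr0.
Qed.

Lemma minkowski_translate_notin (R : realType) (Y : lmodType R) (C : set Y)
    (k y : Y) : cone C -> convex_set C -> C (- k) -> ~ C y ->
  minkowski_functional [set c + k | c in C] y = phi C k y.
Proof.
move=> cC vC Ck nCy; rewrite minkowski_translateE// phiE.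
congr (ereal_inf (image _ _)); apply/seteqP; split=> t /=; first by case.
by move=> Ct; split=> //; exact: (ray_notin_gt0 cC vC Ck nCy).
Qed.

Lemma minkowski_translate_max (R : realType) (Y : lmodType R) (C : set Y)
    (k y : Y) : cone C -> convex_set C -> C (- k) ->
  minkowski_functional [set c + k | c in C] y = maxe (phi C k y) 0%E.
Proof.
move=> cC vC Ck; have [Cy|nCy] := pselect (C y).
  rewrite minkowski_translate_in//; apply/esym/max_idPr.
  rewrite phiE; apply: ge_ereal_inf; exists 0%E => //; exists 0 => //.
  by rewrite /ray/= scale0r subr0.
rewrite -(minkowski_translate_notin cC vC Ck nCy); apply/esym/max_idPl.
exact: minkowski_translate_ge0.
Qed.

Lemma minkowski_translate_fin_num (R : realType) (Y : lmodType R) (C : set Y)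
    (k y : Y) : cone C -> core C (- k) ->
  minkowski_functional [set c + k | c in C] y \is a fin_num.
Proof.
move=> cC corek; rewrite ge0_fin_numE ?minkowski_translate_ge0//.
have [l l0 Cl] := core_absorbing y cC corek.
rewrite minkowski_translateE//; apply: le_lt_trans (ltry l).
apply: ge_ereal_inf; exists l%:E => //; exists l => //; split=> //.
by rewrite /ray/= -scalerN.
Qed.

Lemma minkowski_translate_scale (R : realType) (Y : lmodType R) (C : set Y)
    (k y : Y) (l : R) : cone C -> 0 < l ->
  minkowski_functional [set c + k | c in C] (l *: y) =
  (l%:E * minkowski_functional [set (c + k)%R | c in C] y)%E.
Proof.
move=> cC l0; rewrite !minkowski_translateE// -ereal_inf_pZl//.
congr ereal_inf; apply/seteqP; split=> u /=.
  move=> [t [t0 Ct] <-].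
  have lt : l * (l^-1 * t) = t by rewrite mulrA mulfV ?gt_eqF// mul1r.
  exists (l^-1 * t)%:E; last by rewrite -EFinM lt.
  exists (l^-1 * t) => //; split; first by rewrite mulr_gt0 ?invr_gt0.
  by apply/(ray_scale _ _ _ cC l0); rewrite lt.
move=> [_ [t [t0 Ct] <-] <-]; exists (l * t) => //.
by split; [rewrite mulr_gt0|apply/ray_scale].
Qed.

Lemma minkowski_translate_add (R : realType) (Y : lmodType R) (C : set Y)
    (k x y : Y) : cone C -> convex_set C -> core C (- k) ->
  (minkowski_functional [set (c + k)%R | c in C] (x + y)%R <=
   minkowski_functional [set (c + k)%R | c in C] x +
   minkowski_functional [set (c + k)%R | c in C] y)%E.
Proof.
move=> cC vC corek; apply/lee_addgt0Pr => e e0.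
have e20 : 0 < e / 2 by rewrite divr_gt0.
have := minkowski_translate_fin_num x cC corek.
have := minkowski_translate_fin_num y cC corek.
rewrite !minkowski_translateE//.
move=> /(lb_ereal_inf_adherent e20)[_ [t [t0 Ct] <-] /ltW ty].
move=> /(lb_ereal_inf_adherent e20)[_ [s [s0 Cs] <-] /ltW sx].
rewrite (splitr e) EFinD addeACA; apply: (le_trans _ (leeD sx ty)).
apply: ge_ereal_inf; exists (s + t)%:E => //; exists (s + t) => //.
by split; [exact: addr_gt0|exact: ray_add].
Qed.

Lemma sublinear_minkowski_translate (R : realType) (Y : lmodType R)
    (C : set Y) (k : Y) : cone C -> convex_set C -> core C (- k) ->
  sublinear (minkowski_functional [set c + k | c in C]).
Proof.
move=> cC vC corek; split=> [y|l y|x y].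
- exact: minkowski_translate_fin_num.
- have Ck := core_subset corek.
  rewrite le_eqVlt => /predU1P[<-|l0]; last exact: minkowski_translate_scale.
  rewrite scale0r mul0e minkowski_translate_in//.
  by rewrite -(scale0r (- k)); exact: cC.
- exact: minkowski_translate_add.
Qed.

(** The complement of C is open and translations are continuous. *)
Lemma near_notin_ray (R : realType) (Y : topologicalLmodType R) (C : set Y)
    (k y : Y) (t : R) : closed C -> ~ ray C k y t ->
  nbhs y [set z | ~ ray C k z t].
Proof.
move=> clC nCt.
have ct : (fun z : Y => z - t *: k) z @[z --> y] --> y - t *: k.
  apply: (@continuous_comp _ _ _ (fun z : Y => (z, t *: k))
    (fun p : Y * Y => p.1 - p.2)); last exact: sub_continuous.
  by apply: cvg_pair => /=; [exact: cvg_id|exact: cvg_cst].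
have nC : nbhs (y - t *: k) (~` C).
  by apply: open_nbhs_nbhs; split=> //; exact: closed_openC.
exact: (ct _ nC).
Qed.

Lemma lower_semicontinuous_minkowski_translate (R : realType)
    (Y : topologicalLmodType R) (C : set Y) (k : Y) :
  cone C -> convex_set C -> closed C -> C (- k) ->
  lower_semicontinuous (minkowski_functional [set c + k | c in C]).
Proof.
move=> cC vC clC Ck y a apy.
have [a0|a0] := ltP a 0.
  exists setT; first exact: filterT.
  by move=> z _; apply: lt_le_trans (minkowski_translate_ge0 _ _ cC).
have [b ab nCb] : exists2 b, a < b & ~ ray C k y b.
  apply: contrapT => nb; move: apy; apply/negP; rewrite -leNgt.
  rewrite minkowski_translateE//; apply/lee_addgt0Pr => e e0.
  apply: ge_ereal_inf; exists (a + e)%:E => //; exists (a + e) => //; split.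
    exact: ltr_wpDl.
  by apply: contrapT => nC; apply: nb; exists (a + e); rewrite ?ltrDl.
exists [set z | ~ ray C k z b]; first exact: near_notin_ray.
move=> z /= nCz; apply: (@lt_le_trans _ _ b%:E); first by rewrite lte_fin.
rewrite minkowski_translateE//; apply: le_ereal_inf_tmp => _ [t [_ Ct] <-].
rewrite lee_fin leNgt; apply/negP => /ltW tb; apply: nCz.
exact: (ray_upward cC vC Ck tb).
Qed.

Theorem proposition17 (R : realType) (Y : topologicalLmodType R)
    (C : set Y) (k : Y)
    (C_cone : nontrivial_cone C) (C_closed : closed C) (C_convex : convex_set C)
    (k_core : [set - c | c in core C] k) :
  let p := minkowski_functional [set c + k | c in C] in
  [/\ forall y, (~ C y -> p y = phi C k y) /\ (C y -> p y = 0%E),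
      forall y, p y = maxe (phi C k y) 0%E,
      sublinear p
    & lower_semicontinuous p].
Proof.
have [cC _ _ _] := C_cone.
have corek : core C (- k) by case: k_core => c cc <-; rewrite opprK.
have Ck : C (- k) by exact: core_subset.
split=> [y|y||].
- split=> [nCy|Cy]; first exact: minkowski_translate_notin.
  exact: minkowski_translate_in.
- exact: minkowski_translate_max.
- exact: sublinear_minkowski_translate.
- exact: lower_semicontinuous_minkowski_translate.
Qed.
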